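(* Consider a two-impulse coplanar orbital maneuver between circular orbits: orbit $1$ (initial) and orbit $3$ (final) are circular, $e_1=e_3=0$, and a single transfer orbit, orbit $2$, joins them, with one impulse applied at the junction of orbits $1$ and $2$ (polar angle $\theta_{12}$) and one at the junction of orbits $2$ and $3$ (polar angle $\theta_{23}$). Suppose that (i) the trajectory segments are elliptic, with the Earth's center as a focus, and (ii) the trajectory segments are smooth at the intersection points. Then the only solution is the well-known Hohmann maneuver.
   Context: Orbits are coplanar and described in polar coordinates $(r,\theta)$ about the Earth's center. Orbit $i$ has semi-major axis $a_i$, eccentricity $e_i$ (circular when $e_i=0$) and angle $\omega_i$, and is the curve $r=\dfrac{a_i(1-e_i^2)}{1+e_i\cos(\theta+\omega_i)}$; $\theta+\omega_i$ is the true anomaly, so the perigee is at $\theta+\omega_i=0$ and the apogee at $\theta+\omega_i=\pi$. An $N$-impulse maneuver uses $N$ impulses and $N-1$ intermediate arcs to go from the initial orbit $1$ to the final orbit $N+1$; here $N=2$. A trajectory is smooth if it has $G^0$ and $G^1$ continuity, i.e. consecutive curves intersect and share the same tangent direction at the intersection points. At the junction of orbits $i$ and $i+1$, at polar angle $\theta_{i(i+1)}$, this means that the two curves have the same radius $r$ and the same slope $dr/d\theta$ at that polar angle. A solution is a choice of $(a_2,e_2,\omega_2,\theta_{12},\theta_{23})$ satisfying these conditions at both junctions. The Hohmann maneuver is the one in which the first impulse is applied at the perigee of the transfer orbit ($\theta_{12}+\omega_2=0$, so $a_2=a_1/(1-e_2)$) and the second at its apogee ($\theta_{23}+\omega_2=\pi$,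 so $a_2=a_3/(1+e_2)$), whence the transfer orbit has eccentricity $e_2=\dfrac{a_3-a_1}{a_3+a_1}$.
   Formalization: The two circular orbits are assumed to have different radii (for equal radii other smooth solutions exist), and when orbit 1 is the larger one, the Hohmann maneuver is taken to leave at the apogee and arrive at the perigee, with the roles of orbits 1 and 3 exchanged in its formulas. *)

(* Defs.v *)
From Stdlib Require Import Reals.
From Coquelicot Require Import Coquelicot.
Open Scope R_scope.

Record orbit := Orbit {
  sma : R;  (* semi-major axis [a] *)
  ecc : R;  (* eccentricity [e] *)
  ang : R   (* [omega]; the true anomaly at polar angle [theta] is [theta + omega] *)
}.

Definition elliptic (o : orbit) : Prop := 0 < sma o /\ 0 <= ecc o < 1.

Definition circular (o : orbit) : Prop := ecc o = 0.

Definition radius (o : orbit) (theta : R) : R :=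
  sma o * (1 - ecc o ^ 2) / (1 + ecc o * cos (theta + ang o)).

(* Polar angles are real numbers, so anomalies are compared modulo [2 * PI]. *)
Definition at_perigee (o : orbit) (theta : R) : Prop :=
  exists k : Z, theta + ang o = 2 * IZR k * PI.

Definition at_apogee (o : orbit) (theta : R) : Prop :=
  exists k : Z, theta + ang o = PI + 2 * IZR k * PI.

Definition G0_at (o o' : orbit) (theta : R) : Prop :=
  radius o theta = radius o' theta.

Definition G1_at (o o' : orbit) (theta : R) : Prop :=
  exists s : R, is_derive (radius o) theta s /\ is_derive (radius o') theta s.

Definition smooth_junction (o o' : orbit) (theta : R) : Prop :=
  G0_at o o' theta /\ G1_at o o' theta.

Definition two_impulse_solution (o1 o2 o3 : orbit) (theta12 theta23 : R) : Prop :=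
  elliptic o1 /\ elliptic o2 /\ elliptic o3 /\
  smooth_junction o1 o2 theta12 /\ smooth_junction o2 o3 theta23.

Definition hohmann_raising (o1 o2 o3 : orbit) (theta12 theta23 : R) : Prop :=
  at_perigee o2 theta12 /\ sma o2 = sma o1 / (1 - ecc o2) /\
  at_apogee o2 theta23 /\ sma o2 = sma o3 / (1 + ecc o2) /\
  ecc o2 = (sma o3 - sma o1) / (sma o3 + sma o1).

(* With [0 <= ecc o2], "perigee first" presupposes [sma o1 < sma o3].  A transfer
   to a lower orbit is the same maneuver flown backwards: it leaves [o1] at the
   apogee of [o2] and reaches [o3] at its perigee. *)
Definition hohmann (o1 o2 o3 : orbit) (theta12 theta23 : R) : Prop :=
  (sma o1 < sma o3 /\ hohmann_raising o1 o2 o3 theta12 theta23) \/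
  (sma o3 < sma o1 /\ hohmann_raising o3 o2 o1 theta23 theta12).

(* Main.v *)
(* The radius of a circular orbit has slope 0, and that of an ellipse with [e > 0]
   is stationary exactly where [sin] of the true anomaly vanishes.  So each junction
   is at an apsis of the transfer orbit; since the two circles have different radii,
   one junction is at the perigee and the other at the apogee. *)
Require Import Defs.
From Stdlib Require Import Reals Lra.
From Coquelicot Require Import Coquelicot.
Open Scope R_scope.

(** By [cos (2 * x) = 1 - 2 * sin x * sin x] at [x = k * PI], a zero of [sin]; this covers negative
    [k] too. *)
Lemma cos_2kPI (k : Z) : cos (2 * IZR k * PI) = 1.
Proof.
  replace (2 * IZR k * PI) with (2 * (IZR k * PI)) by ring.
  rewrite cos_2a_sin, sin_eq_0_1 by (exists k; reflexivity); ring.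
Qed.

Lemma cos_at_perigee (o : orbit) (theta : R) :
  at_perigee o theta -> cos (theta + ang o) = 1.
Proof. intros [k ->]; apply cos_2kPI. Qed.

Lemma cos_at_apogee (o : orbit) (theta : R) :
  at_apogee o theta -> cos (theta + ang o) = -1.
Proof.
  intros [k ->].
  rewrite Rplus_comm, neg_cos, cos_2kPI; ring.
Qed.

Lemma sin_anomaly_eq_0 (o : orbit) (theta : R) :
  sin (theta + ang o) = 0 <-> at_perigee o theta \/ at_apogee o theta.
Proof.
  split.
  - intros H; destruct (sin_eq_0_0 _ H) as [k Hk].
    (* Even multiples of [PI] are perigees, odd ones apogees. *)
    destruct (Z.Even_or_Odd k) as [[m ->] | [m ->]]; [left | right]; exists m;
      rewrite Hk, ?plus_IZR, mult_IZR; ring.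
  - intros [[k ->] | [k ->]]; apply sin_eq_0_1.
    + exists (2 * k)%Z; rewrite mult_IZR; ring.
    + exists (2 * k + 1)%Z; rewrite plus_IZR, mult_IZR; ring.
Qed.

Lemma radius_denom_pos (o : orbit) (theta : R) :
  elliptic o -> 0 < 1 + ecc o * cos (theta + ang o).
Proof. intros [_ He]; pose proof (COS_bound (theta + ang o)); nra. Qed.

Lemma is_derive_radius (o : orbit) (theta : R) :
  elliptic o ->
  is_derive (radius o) theta
    (sma o * (1 - ecc o ^ 2) * ecc o * sin (theta + ang o)
     / (1 + ecc o * cos (theta + ang o)) ^ 2).
Proof.
  intros Ho; pose proof (radius_denom_pos o theta Ho).
  unfold radius; auto_derive; [lra | field; lra].
Qed.

Lemma radius_circular (c : orbit) (theta : R) :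
  circular c -> radius c theta = sma c.
Proof. unfold circular, radius; intros ->; field. Qed.

Lemma radius_perigee (o : orbit) (theta : R) :
  elliptic o -> at_perigee o theta -> radius o theta = sma o * (1 - ecc o).
Proof.
  intros [_ He] H; unfold radius; rewrite (cos_at_perigee _ _ H); field; lra.
Qed.

Lemma radius_apogee (o : orbit) (theta : R) :
  elliptic o -> at_apogee o theta -> radius o theta = sma o * (1 + ecc o).
Proof.
  intros [_ He] H; unfold radius; rewrite (cos_at_apogee _ _ H); field; lra.
Qed.

Lemma smooth_junction_sym (o o' : orbit) (theta : R) :
  smooth_junction o o' theta -> smooth_junction o' o theta.
Proof. intros [H0 [s [H H']]]; split; [now symmetry | now exists s]. Qed.

(** Time reversal: it reduces a transfer to a lower orbit to the raising case. *)
Lemma two_impulse_solution_sym (o1 o2 o3 : orbit) (theta12 theta23 : R) :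
  two_impulse_solution o1 o2 o3 theta12 theta23 ->
  two_impulse_solution o3 o2 o1 theta23 theta12.
Proof.
  intros (H1 & H2 & H3 & J & J'); repeat (split; [assumption |]).
  split; now apply smooth_junction_sym.
Qed.

(** Tangency to the circle selects an apsis, and equality of radii then ties [sma c] to the apsidal
    distance. With [ecc o = 0] tangency would select nothing. *)
Lemma smooth_junction_circular (c o : orbit) (theta : R) :
  elliptic c -> circular c -> elliptic o -> ecc o <> 0 ->
  smooth_junction c o theta <->
  (at_perigee o theta /\ sma c = sma o * (1 - ecc o)) \/
  (at_apogee o theta /\ sma c = sma o * (1 + ecc o)).
Proof.
  intros Ec Cc Eo Ne.
  pose proof (is_derive_radius c theta Ec) as Dc.
  pose proof (is_derive_radius o theta Eo) as Do.
  pose proof (radius_denom_pos o theta Eo) as Hd.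
  unfold smooth_junction, G0_at; rewrite (radius_circular c theta Cc).
  rewrite Cc in Dc.
  split.
  - intros [H0 [s [Hc Ho]]].
    assert (Hs : sin (theta + ang o) = 0).
    { apply is_derive_unique in Dc, Do, Hc, Ho.
      rewrite Hc in Dc; rewrite Ho in Do; rewrite Dc in Do.
      replace (sma c * (1 - 0 ^ 2) * 0 * sin (theta + ang c)
               / (1 + 0 * cos (theta + ang c)) ^ 2) with 0 in Do by field.
      (* In the slope of [o], only the factor [sin] can vanish. *)
      assert (Hk : sma o * (1 - ecc o ^ 2) * ecc o <> 0).
      { destruct Eo as [Ha He].
        repeat apply Rmult_integral_contrapositive_currified; nra. }
      apply Rmult_eq_reg_l with (2 := Hk).
      (* Clear the denominator, which [Hd] keeps positive. *)
      apply (f_equal (fun x => x * (1 + ecc o * cos (theta + ang o)) ^ 2)) in Do.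
      field_simplify in Do; [lra | lra]. }
    apply sin_anomaly_eq_0 in Hs; destruct Hs as [P | A]; [left | right];
      (split; [assumption |]); rewrite H0.
    + now apply radius_perigee.
    + now apply radius_apogee.
  - intros H.
    assert (Hs : sin (theta + ang o) = 0) by (apply sin_anomaly_eq_0; tauto).
    split.
    + destruct H as [[P ->] | [A ->]].
      * now rewrite radius_perigee.
      * now rewrite radius_apogee.
    + exists 0; split.
      * replace 0 with (sma c * (1 - 0 ^ 2) * 0 * sin (theta + ang c)
               / (1 + 0 * cos (theta + ang c)) ^ 2) by field; exact Dc.
      * rewrite Hs in Do.
        replace 0 with (sma o * (1 - ecc o ^ 2) * ecc o * 0
               / (1 + ecc o * cos (theta + ang o)) ^ 2) by (field; lra); exact Do.
Qed.

(** This excludes a circular transfer orbit: it would have the radius of both given circles. *)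
Lemma smooth_junction_two_circular (c o : orbit) (theta : R) :
  circular c -> circular o -> smooth_junction c o theta -> sma c = sma o.
Proof.
  intros Cc Co [H _]; unfold G0_at in H.
  now rewrite !radius_circular in H.
Qed.

(** The two apsidal distances have sum [2 * sma o2] and difference [2 * sma o2 * ecc o2]; their
    quotient is the eccentricity formula. *)
Lemma hohmann_raising_intro (o1 o2 o3 : orbit) (theta12 theta23 : R) :
  elliptic o2 ->
  at_perigee o2 theta12 -> sma o1 = sma o2 * (1 - ecc o2) ->
  at_apogee o2 theta23 -> sma o3 = sma o2 * (1 + ecc o2) ->
  hohmann_raising o1 o2 o3 theta12 theta23.
Proof.
  intros [Ha He] P H1 A H3; unfold hohmann_raising; rewrite H1, H3.
  repeat (split; [assumption || (field; lra) |]); field; lra.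
Qed.

(** That [o2] is elliptic is derived here: [0 < sma o1 < sma o3] puts the prescribed eccentricity
    strictly between 0 and 1. *)
Lemma hohmann_raising_solution (o1 o2 o3 : orbit) (theta12 theta23 : R) :
  elliptic o1 -> elliptic o3 -> circular o1 -> circular o3 -> sma o1 < sma o3 ->
  hohmann_raising o1 o2 o3 theta12 theta23 ->
  two_impulse_solution o1 o2 o3 theta12 theta23.
Proof.
  intros E1 E3 C1 C3 Hlt (P & H1 & A & H3 & He).
  pose proof (proj1 E1) as P1.
  assert (He0 : 0 < ecc o2).
  { rewrite He; apply Rdiv_lt_0_compat; lra. }
  assert (He1 : ecc o2 < 1).
  { rewrite He; apply Rlt_div_l; lra. }
  assert (E2 : elliptic o2).
  { split; [rewrite H1; apply Rdiv_lt_0_compat; lra | lra]. }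
  repeat (split; [assumption |]).
  split; [| apply smooth_junction_sym]; apply smooth_junction_circular;
    try assumption; try lra.
  - left; split; [assumption |]; rewrite H1; field; lra.
  - right; split; [assumption |]; rewrite H3; field; lra.
Qed.

Lemma hohmann_raising_exists (o1 o3 : orbit) :
  elliptic o1 -> elliptic o3 ->
  exists (o2 : orbit) (theta12 theta23 : R),
    hohmann_raising o1 o2 o3 theta12 theta23.
Proof.
  intros [P1 _] [P3 _].
  (* The major axis spans both radii, so its half is their mean; [ang = 0] puts the perigee at polar
     angle 0. *)
  exists (Orbit ((sma o1 + sma o3) / 2) ((sma o3 - sma o1) / (sma o3 + sma o1)) 0), 0, PI.
  unfold hohmann_raising, at_perigee, at_apogee; simpl.
  split; [exists 0%Z; ring |].
  split; [field; lra |].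
  split; [exists 0%Z; ring |].
  split; [field; lra | reflexivity].
Qed.

Theorem proposition3p2 (o1 o3 : orbit)
  (ell1 : elliptic o1) (ell3 : elliptic o3)
  (circ1 : circular o1) (circ3 : circular o3)
  (distinct : sma o1 <> sma o3) :
  (exists (o2 : orbit) (theta12 theta23 : R),
     two_impulse_solution o1 o2 o3 theta12 theta23) /\
  (forall (o2 : orbit) (theta12 theta23 : R),
     two_impulse_solution o1 o2 o3 theta12 theta23 <->
     hohmann o1 o2 o3 theta12 theta23).
Proof.
  split.
  - destruct (Rdichotomy _ _ distinct) as [Hlt | Hgt].
    + destruct (hohmann_raising_exists o1 o3 ell1 ell3) as (o2 & t & t' & H).
      exists o2, t, t'; now apply hohmann_raising_solution.
    + destruct (hohmann_raising_exists o3 o1 ell3 ell1) as (o2 & t & t' & H).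
      exists o2, t', t; now apply two_impulse_solution_sym, hohmann_raising_solution.
  - intros o2 t t'; split.
    + intros (_ & E2 & _ & J & J'); apply smooth_junction_sym in J'.
      destruct (Req_dec (ecc o2) 0) as [C2 | Ne].
      { apply smooth_junction_two_circular in J, J'; try assumption; congruence. }
      pose proof E2 as [Ha He].
      apply smooth_junction_circular in J, J'; try assumption.
      (* Two junctions at the same kind of apsis would give equal radii, against [distinct]. In the
         mixed cases, [0 < ecc o2] decides which circle is larger. *)
      destruct J as [[P H] | [A H]], J' as [[P' H'] | [A' H']]; try congruence.
      * left; split; [nra | now apply hohmann_raising_intro].
      * right; split; [nra | now apply hohmann_raising_intro].
    + intros [[Hlt H] | [Hlt H]].
      * now apply hohmann_raising_solution.
      * now apply two_impulse_solution_sym, hohmann_raising_solution.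
Qed.
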